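(* Let $G$ and $H$ be groups acting on each other and acting on themselves by conjugation. If the mutual actions are compatible, then the following hold: (i) if $G$ or $H$ is solvable by finite, then the non-abelian tensor product $G\otimes H$ is solvable by finite; (ii) if $G$ or $H$ is nilpotent by finite, then $G\otimes H$ is nilpotent by finite.
   Context: Groups act on themselves by conjugation on the left: ${}^{g}g'=gg'g^{-1}$. Let $G$ act on $H$ and $H$ act on $G$ by automorphisms (left actions, written ${}^{g}h$ and ${}^{h}g$). The mutual actions are compatible if ${}^{({}^{h}g)}h'={}^{hgh^{-1}}h'$ and ${}^{({}^{g}h)}g'={}^{ghg^{-1}}g'$ for all $g,g'\in G$, $h,h'\in H$, where ${}^{hgh^{-1}}h'$ means $h\cdot {}^{g}(h^{-1}h'h)\cdot h^{-1}$ and ${}^{ghg^{-1}}g'$ means $g\cdot {}^{h}(g^{-1}g'g)\cdot g^{-1}$. For compatible actions, the non-abelian tensor product $G\otimes H$ is the group generated by symbols $g\otimes h$ ($g\in G$, $h\in H$) with relations $gg'\otimes h=({}^{g}g'\otimes {}^{g}h)(g\otimes h)$ and $g\otimes hh'=(g\otimes h)({}^{h}g\otimes {}^{h}h')$ for all $g,g'\in G$, $h,h'\in H$. A group $E$ is ''solvable by finite'' (resp. ''nilpotent by finite'') if there is an exact sequence $1\to S\to E\to F\to 1$ with $S$ solvable (resp. nilpotent) and $F$ finite. *)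

(* Defs.v *)
From HB Require Import structures.
From mathcomp Require Import all_boot fingroup.
From mathcomp Require Import boolp classical_sets.

Set Implicit Arguments.
Unset Strict Implicit.
Unset Printing Implicit Defensive.

Local Open Scope classical_set_scope.
Local Open Scope quotient_scope.
Local Open Scope group_scope.

Section SolvableNilpotent.
Variable G : groupType.

Definition subgroup (A : set G) : Prop :=
  A 1 /\ forall x y, A x -> A y -> A (x / y).

Definition gen (A : set G) : set G := smallest subgroup A.

Definition commutator_subgroup (A B : set G) : set G :=
  gen [set [~ x, y] | x in A & y in B].

Fixpoint derived_series (n : nat) : set G :=
  if n is m.+1 then
    commutator_subgroup (derived_series m) (derived_series m)
  else [set: G].

Fixpoint lower_central_series (n : nat) : set G :=
  if n is m.+1 then commutator_subgroup (lower_central_series m) [set: G]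
  else [set: G].

Definition solvable_group : Prop := exists n, derived_series n = [set 1].

Definition nilpotent_group : Prop :=
  exists n, lower_central_series n = [set 1].

End SolvableNilpotent.

Definition short_exact (S E F : groupType)
    (i : {multiplicative S -> E}) (p : {multiplicative E -> F}) : Prop :=
  [/\ injective i, range i = [set x | p x = 1] & range p = [set: F]].

Definition by_finite (P : groupType -> Prop) (E : groupType) : Prop :=
  exists (S : groupType) (F : finGroupType)
    (i : {multiplicative S -> E}) (p : {multiplicative E -> F}),
    P S /\ short_exact i p.

Definition solvable_by_finite : groupType -> Prop := by_finite solvable_group.

Definition nilpotent_by_finite : groupType -> Prop :=
  by_finite nilpotent_group.

(* The group with generators X and relations R is the quotient of the formal
   group expressions over X by the least congruence that contains R and the
   group axioms. *)
Inductive gterm (X : Type) : Type :=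
| GGen of X
| GOne
| GMul of gterm X & gterm X
| GInv of gterm X.

Arguments GOne {X}.

Inductive gterm_eq (X : Type) (R : gterm X -> gterm X -> Prop) :
    gterm X -> gterm X -> Prop :=
| gterm_eq_rel s t : R s t -> gterm_eq R s t
| gterm_eq_refl s : gterm_eq R s s
| gterm_eq_sym s t : gterm_eq R s t -> gterm_eq R t s
| gterm_eq_trans s t u :
    gterm_eq R s t -> gterm_eq R t u -> gterm_eq R s u
| gterm_eq_mul s s' t t' :
    gterm_eq R s s' -> gterm_eq R t t' ->
    gterm_eq R (GMul s t) (GMul s' t')
| gterm_eq_inv s t : gterm_eq R s t -> gterm_eq R (GInv s) (GInv t)
| gterm_eq_mulA s t u :
    gterm_eq R (GMul s (GMul t u)) (GMul (GMul s t) u)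
| gterm_eq_mul1 s : gterm_eq R (GMul GOne s) s
| gterm_eq_mulr1 s : gterm_eq R (GMul s GOne) s
| gterm_eq_mulV s : gterm_eq R (GMul (GInv s) s) GOne
| gterm_eq_mulrV s : gterm_eq R (GMul s (GInv s)) GOne.

HB.instance Definition _ (X : Type) := gen_eqMixin (gterm X).
HB.instance Definition _ (X : Type) := gen_choiceMixin (gterm X).

Section Presentation.
Variables (X : Type) (R : gterm X -> gterm X -> Prop).

Definition gterm_eqb : rel (gterm X) := fun s t => `[< gterm_eq R s t >].

Lemma gterm_eqb_equiv : equiv_class_of gterm_eqb.
Proof.
split=> [s|s t|t s u].
- exact/asboolP/gterm_eq_refl.
- by apply/asboolP/asboolP => /gterm_eq_sym.
- by move=> /asboolP st /asboolP tu; apply/asboolP/(gterm_eq_trans st tu).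
Qed.

Canonical gterm_equiv := EquivRelPack gterm_eqb_equiv.

Definition presented_group : Type := {eq_quot gterm_equiv}.

HB.instance Definition _ := Choice.on presented_group.
HB.instance Definition _ := EqQuotient.on presented_group.

Definition pres_class (s : gterm X) : presented_group :=
  \pi_presented_group s.

Definition pres_repr (x : presented_group) : gterm X := generic_quotient.repr x.

Lemma pres_reprK (x : presented_group) : pres_class (pres_repr x) = x.
Proof. exact: reprK. Qed.

Lemma pres_classP (s t : gterm X) :
  pres_class s = pres_class t <-> gterm_eq R s t.
Proof.
split=> [/eqmodP/asboolP //|st].
by apply/eqmodP/asboolP.
Qed.

Lemma pres_classK (s : gterm X) : gterm_eq R (pres_repr (pres_class s)) s.
Proof. by apply/pres_classP; rewrite pres_reprK. Qed.

Definition pres_one : presented_group := pres_class GOne.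
Definition pres_mul (x y : presented_group) : presented_group :=
  pres_class (GMul (pres_repr x) (pres_repr y)).
Definition pres_inv (x : presented_group) : presented_group :=
  pres_class (GInv (pres_repr x)).

Lemma pres_classM s t :
  pres_class (GMul s t) = pres_mul (pres_class s) (pres_class t).
Proof.
by apply/pres_classP/gterm_eq_mul; apply/gterm_eq_sym/pres_classK.
Qed.

Lemma pres_classV s : pres_class (GInv s) = pres_inv (pres_class s).
Proof. by apply/pres_classP/gterm_eq_inv/gterm_eq_sym/pres_classK. Qed.

Lemma pres_mulA : associative pres_mul.
Proof.
move=> x y z; rewrite -[x]pres_reprK -[y]pres_reprK -[z]pres_reprK.
by rewrite -!pres_classM; apply/pres_classP/gterm_eq_mulA.
Qed.

Lemma pres_mul1 : left_id pres_one pres_mul.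
Proof.
move=> x; rewrite -[x]pres_reprK -pres_classM.
exact/pres_classP/gterm_eq_mul1.
Qed.

Lemma pres_mulr1 : right_id pres_one pres_mul.
Proof.
move=> x; rewrite -[x]pres_reprK -pres_classM.
exact/pres_classP/gterm_eq_mulr1.
Qed.

Lemma pres_mulV : left_inverse pres_one pres_inv pres_mul.
Proof.
move=> x; rewrite -[x]pres_reprK -pres_classV -pres_classM.
exact/pres_classP/gterm_eq_mulV.
Qed.

Lemma pres_mulrV : right_inverse pres_one pres_inv pres_mul.
Proof.
move=> x; rewrite -[x]pres_reprK -pres_classV -pres_classM.
exact/pres_classP/gterm_eq_mulrV.
Qed.

HB.instance Definition _ := isGroup.Build presented_group
  pres_mulA pres_mul1 pres_mulr1 pres_mulV pres_mulrV.

End Presentation.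

(* [a g x] is the left action of g on x. *)
Record aut_action (G H : groupType) (a : G -> H -> H) : Prop := AutAction {
  aut_act1 : forall x, a 1 x = x;
  aut_actM : forall g g' x, a (g * g') x = a g (a g' x);
  aut_act_morph : forall g, {morph a g : x y / x * y}
}.

(* Left conjugation: the library's [x ^ g] is [g^-1 * x * g]. *)
Definition lconj (G : groupType) (g x : G) : G := g * x * g^-1.

Definition compatible_actions (G H : groupType)
    (aGH : G -> H -> H) (aHG : H -> G -> G) : Prop :=
  (forall (g : G) (h h' : H),
     aGH (aHG h g) h' = h * aGH g (h^-1 * h' * h) * h^-1) /\
  (forall (g g' : G) (h : H),
     aHG (aGH g h) g' = g * aHG h (g^-1 * g' * g) * g^-1).

Section TensorProduct.
Variables (G H : groupType) (aGH : G -> H -> H) (aHG : H -> G -> G).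

Definition tensor_sym (g : G) (h : H) : gterm (G * H) := GGen (g, h).

Inductive tensor_rel : gterm (G * H) -> gterm (G * H) -> Prop :=
| tensor_rel_l (g g' : G) (h : H) :
    tensor_rel (tensor_sym (g * g') h)
      (GMul (tensor_sym (lconj g g') (aGH g h)) (tensor_sym g h))
| tensor_rel_r (g : G) (h h' : H) :
    tensor_rel (tensor_sym g (h * h'))
      (GMul (tensor_sym g h) (tensor_sym (aHG h g) (lconj h h'))).

Definition tensor : groupType := presented_group tensor_rel.

End TensorProduct.

(* Main.v *)
Require Import Defs.
From mathcomp Require Import all_boot fingroup.
From HB Require Import structures.
From mathcomp Require Import boolp classical_sets.

(** The tensor product maps onto a subgroup of each of the two factors: the
    rules [g (x) h |-> g * h.g^-1] and [g (x) h |-> g.h * h^-1] define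
    homomorphisms from [G (x) H] to [G] and to [H], and both have a central
    kernel.  Indeed, conjugation by [g (x) h] acts on the generators as the
    commutator of [g] and [h] acts on both entries
    ([tensor_sym_comm], obtained by expanding [g g' (x) h h'] in the two
    possible ways), and compatibility says that the images of [g (x) h] in [G]
    and in [H] act as this commutator too.  Hence an element with trivial image
    commutes with all generators ([central_kernel_tensor]).

    Being solvable by finite and being nilpotent by finite both pass to any
    group [E] with a homomorphism [f] to [G] whose kernel is central
    ([by_finite_central_kernel]): if [S] is normal of finite index in [G], then
    [f^-1(S)] has finite index in [E], and it is a central extension of a
    subgroup of [S].  A central extension adds at most one term to the derived
    series and to the lower central series, so it inherits solvability and
    nilpotency.  Applying this to the two homomorphisms above gives the result
    for a hypothesis on [G] or on [H]. *)

Set Implicit Arguments.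
Unset Strict Implicit.
Unset Printing Implicit Defensive.

Local Open Scope classical_set_scope.
Local Open Scope group_scope.

(** * Homomorphisms with central kernel *)

Section GroupMorphism.
Variables (A B : groupType) (f : {multiplicative A -> B}).

Lemma mult1 : f 1 = 1.
Proof. by apply: (mulgI (f 1)); rewrite -gmulfM !mulg1. Qed.

Lemma multV : {morph f : x / x^-1}.
Proof. by move=> x; apply/esym/mulg1_eq; rewrite -gmulfM mulgV mult1. Qed.

Lemma multF : {morph f : x y / x / y}.
Proof. by move=> x y; rewrite gmulfM multV. Qed.

Lemma multR : {morph f : x y / [~ x, y]}.
Proof. by move=> x y; rewrite !gmulfM !multV. Qed.

End GroupMorphism.

Definition central_kernel (A B : groupType) (f : A -> B) : Prop :=
  forall x, f x = 1 -> forall y, commute x y.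

Section Gen.
Variable A : groupType.

Lemma subgroup_gen (X : set A) : subgroup (gen X).
Proof.
split=> [M [[M1 _] _] //|x y xX yX M MX].
by have [[_ MV] _] := MX; apply: MV; [apply: xX | apply: yX].
Qed.

Lemma gen_sub1 (X : set A) : X `<=` [set 1] -> gen X = [set 1].
Proof.
move=> X1; apply/seteqP; split=> [|x ->]; last exact: (subgroup_gen X).1.
apply: smallest_sub => //; split=> // x y -> ->; exact: divg1.
Qed.

Lemma commutator_subgroup_central (X Y : set A) :
  (forall x y, X x -> commute x y) -> commutator_subgroup X Y = [set 1].
Proof.
move=> Xc; apply: gen_sub1 => _ [x Xx [y _ <-]].
exact/eqP/commgP/Xc.
Qed.

End Gen.

Section Series.
Variables (A B : groupType) (f : {multiplicative A -> B}).

Lemma mult_commutator_subgroup (X Y : set A) (X' Y' : set B) :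
  (forall x, X x -> X' (f x)) -> (forall y, Y y -> Y' (f y)) ->
  forall z, commutator_subgroup X Y z -> commutator_subgroup X' Y' (f z).
Proof.
move=> XX' YY'; have [g1 gV] := subgroup_gen [set [~ x, y] | x in X' & y in Y'].
apply: (@smallest_sub _ _ _ [set z | commutator_subgroup X' Y' (f z)]).
  split=> /= [|x y fx fy]; first by rewrite mult1.
  by rewrite multF; apply: gV.
move=> _ [x Xx [y Yy <-]] /=; rewrite multR.
by apply: sub_gen_smallest; exists (f x); [exact: XX' | exists (f y); auto].
Qed.

Lemma mult_derived_series n x :
  derived_series n x -> derived_series n (f x).
Proof. by elim: n x => [|n IHn] //=; apply: mult_commutator_subgroup. Qed.

Lemma mult_lower_central_series n x :
  lower_central_series n x -> lower_central_series n (f x).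
Proof. by elim: n x => [|n IHn] //=; apply: mult_commutator_subgroup. Qed.

Hypothesis f_central : central_kernel f.

(** The term of the series of [A] that is mapped to the trivial term of [B] lies
    in the kernel, hence in the center, and the next term vanishes. *)
Lemma solvable_central_kernel : solvable_group B -> solvable_group A.
Proof.
move=> [n n1]; exists n.+1; apply: commutator_subgroup_central => x y Ax.
by apply: f_central; have:= mult_derived_series Ax; rewrite n1.
Qed.

Lemma nilpotent_central_kernel : nilpotent_group B -> nilpotent_group A.
Proof.
move=> [n n1]; exists n.+1; apply: commutator_subgroup_central => x y Ax.
by apply: f_central; have:= mult_lower_central_series Ax; rewrite n1.
Qed.

End Series.

(** * Kernels and images of homomorphisms *)

Section Kernel.
Variables (A B : groupType) (f : {multiplicative A -> B}).

Definition in_kernel : pred A := fun x => f x == 1.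

Lemma in_kernel_group_closed : group_closed in_kernel.
Proof.
split=> [|x y]; rewrite !unfold_in /in_kernel; first by rewrite mult1.
by move=> /eqP fx /eqP fy; rewrite multF fx fy divg1.
Qed.

Definition kernel : Type := {x | in_kernel x}.

HB.instance Definition _ := SubChoice.on kernel.
HB.instance Definition _ :=
  SubChoice_isSubGroup.Build A in_kernel kernel in_kernel_group_closed.

End Kernel.

(** The finite group in [by_finite] has to be the exact image, so a homomorphism
    to a finite group is first made surjective. *)
Lemma corestrict_fin (E : groupType) (F : finGroupType)
    (q : {multiplicative E -> F}) :
  exists (F' : finGroupType) (r : {multiplicative E -> F'}),
    range r = [set: F'] /\ forall x, r x = 1 <-> q x = 1.
Proof.
pose A : {set F} := [set y | `[< exists x, q x = y >]]%SET.
have inA x : q x \in A by rewrite inE; apply: asboolT; exists x.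
have groupA : group_set A.
  apply/group_setP; split=> [|y z]; first by rewrite -(mult1 q).
  rewrite !inE => -[x <-] [x' <-].
  by exists (x * x'); rewrite gmulfM.
pose r x : subg_of (Group groupA) := subg (Group groupA) (q x).
have val_r x : sgval (r x) = q x by apply: subgK; apply: inA.
have rM : {morph r : x y / x * y}.
  by move=> x y; apply: subg_inj; rewrite val_r gmulfM -!val_r.
pose rm : {multiplicative E -> _} := HB.pack r (isMultiplicative.Build _ _ r rM).
exists (subg_of (Group groupA)), rm; split.
  apply/seteqP; split=> // u _; have := subgP u.
  rewrite /= inE => /asboolP[x qx]; exists x => //.
  by apply: subg_inj; rewrite val_r.
move=> x; split=> [rx1|qx1]; last by apply: subg_inj; rewrite val_r qx1.
by rewrite -val_r (_ : r x = 1).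
Qed.

(** The pullback of [S] along [f] is the kernel of [E -> G -> F]; it maps to [S]
    with a central kernel. *)
Lemma by_finite_central_kernel (P : groupType -> Prop)
    (P_ext : forall (A B : groupType) (f : {multiplicative A -> B}),
       central_kernel f -> P B -> P A)
    (E G : groupType) (f : {multiplicative E -> G}) :
  central_kernel f -> by_finite P G -> by_finite P E.
Proof.
move=> f_central [S [F [i [p [PS [i_inj i_im _]]]]]].
have [F' [r [r_surj r_ker]]] := corestrict_fin (p \o f : {multiplicative E -> F}).
have lift (u : kernel r) : exists s, i s = f (val u).
  have /r_ker pfu : r (val u) = 1 by apply/eqP; apply: (valP u).
  have : [set x | p x = 1] (f (val u)) by [].
  by rewrite -i_im => -[s _ <-]; exists s.
have [j ij] := choice lift.
have jM : {morph j : u v / u * v}.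
  by move=> u v; apply: i_inj; rewrite gmulfM !ij valM gmulfM.
pose jm : {multiplicative kernel r -> S} :=
  HB.pack j (isMultiplicative.Build _ _ j jM).
exists (kernel r), F', (val : kernel r -> E), r; split.
  apply: (P_ext _ _ jm) => // u ju1 v; apply: val_inj.
  rewrite !valM; apply: f_central.
  by rewrite -ij (_ : j u = 1) ?mult1.
split=> //; first exact: val_inj.
apply/seteqP; split=> [_ [u _ <-]|x /= rx1]; first by apply/eqP; apply: (valP u).
have kx : in_kernel r x by apply/eqP.
by exists (Sub x kx); rewrite ?SubK.
Qed.

(** * Presented groups *)

Section Presentation.
Variables (X : Type) (R : gterm X -> gterm X -> Prop).

Lemma presented_group_ind (P : presented_group R -> Prop) :
  (forall x, P (pres_class R (GGen x))) -> P 1 ->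
  (forall u v, P u -> P v -> P (u * v)) -> (forall u, P u -> P u^-1) ->
  forall u, P u.
Proof.
move=> Pgen P1 PM PV u; rewrite -[u]pres_reprK.
elim: (pres_repr u) => [x||s Ps t Pt|s Ps] //.
- by rewrite pres_classM; apply: PM.
- by rewrite pres_classV; apply: PV.
Qed.

Variables (K : groupType) (f : X -> K).

Fixpoint gterm_eval (s : gterm X) : K :=
  match s with
  | GGen x => f x
  | GOne => 1
  | GMul s t => gterm_eval s * gterm_eval t
  | GInv s => (gterm_eval s)^-1
  end.

Hypothesis f_rel : forall s t, R s t -> gterm_eval s = gterm_eval t.

Lemma gterm_eval_eq s t : gterm_eq R s t -> gterm_eval s = gterm_eval t.
Proof.
elim=> {s t} //=.
- by move=> s t u _ -> _ ->.
- by move=> s s' t t' _ -> _ ->.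
- by move=> s t _ ->.
- by move=> s t u; rewrite mulgA.
- by move=> s; rewrite mul1g.
- by move=> s; rewrite mulg1.
- by move=> s; rewrite mulVg.
- by move=> s; rewrite mulgV.
Qed.

Lemma pres_hom_exists : exists F : {multiplicative presented_group R -> K},
  forall x, F (pres_class R (GGen x)) = f x.
Proof.
pose F (u : presented_group R) := gterm_eval (pres_repr u).
have FM : {morph F : u v / u * v}.
  by move=> u v; rewrite /F (gterm_eval_eq (pres_classK _ _)).
pose Fm : {multiplicative presented_group R -> K} :=
  HB.pack F (isMultiplicative.Build _ _ F FM).
exists Fm => x.
exact: (gterm_eval_eq (pres_classK _ _)).
Qed.

End Presentation.

(** * The tensor product *)

Section Action.
Variables (G H : groupType) (a : G -> H -> H).
Hypothesis a_action : aut_action a.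

Lemma aut_actg1 g : a g 1 = 1.
Proof.
by apply: (mulgI (a g 1)); rewrite -(aut_act_morph a_action) !mulg1.
Qed.

Lemma aut_actV g x : a g x^-1 = (a g x)^-1.
Proof.
apply/esym/mulg1_eq.
by rewrite -(aut_act_morph a_action) mulgV aut_actg1.
Qed.

Lemma aut_actK g : cancel (a g) (a g^-1).
Proof.
by move=> x; rewrite -(aut_actM a_action) mulVg (aut_act1 a_action).
Qed.

Lemma aut_actVK g : cancel (a g^-1) (a g).
Proof.
by move=> x; rewrite -(aut_actM a_action) mulgV (aut_act1 a_action).
Qed.

End Action.

Lemma lconj_action (G : groupType) : aut_action (@lconj G).
Proof.
by split=> [x|g g' x|g x y]; rewrite /lconj !gnorm.
Qed.

Section Tensor.
Variables (G H : groupType) (aGH : G -> H -> H) (aHG : H -> G -> G).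
Hypotheses (aGH_action : aut_action aGH) (aHG_action : aut_action aHG).
Hypothesis compat : compatible_actions aGH aHG.

Definition tens (g : G) (h : H) : tensor aGH aHG :=
  pres_class (tensor_rel aGH aHG) (tensor_sym g h).

Lemma tensMl g g' h :
  tens (g * g') h = tens (lconj g g') (aGH g h) * tens g h.
Proof.
rewrite /tens -[RHS]pres_classM.
exact/pres_classP/gterm_eq_rel/tensor_rel_l.
Qed.

Lemma tensMr g h h' :
  tens g (h * h') = tens g h * tens (aHG h g) (lconj h h').
Proof.
rewrite /tens -[RHS]pres_classM.
exact/pres_classP/gterm_eq_rel/tensor_rel_r.
Qed.

(** Substituting [lconj h b] in the compatibility condition cancels its inner
    conjugation, and both conditions become commutation rules. *)
Lemma compat_lconj_H g h b : aGH (aHG h g) (lconj h b) = lconj h (aGH g b).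
Proof. by rewrite compat.1 /lconj !gnorm. Qed.

Lemma compat_lconj_G g h a : aHG (aGH g h) (lconj g a) = lconj g (aHG h a).
Proof. by rewrite compat.2 /lconj !gnorm. Qed.

(** The element [g * g' (x) h * h'] can be expanded by first splitting either
    entry; both expansions share their outer factors, and cancelling these
    leaves the relation. *)
Lemma tensor_sym_comm g h a b :
  tens (lconj g (aHG h a)) (aGH g (lconj h b)) * tens g h =
  tens g h * tens (aHG h (lconj g a)) (lconj h (aGH g b)).
Proof.
have lconjM (K L : groupType) (c : K -> L -> L) : aut_action c ->
    forall k x y, c k (lconj x y) = lconj (c k x) (c k y).
  by move=> cA k x y; rewrite /lconj !(aut_act_morph cA) (aut_actV cA).
have : tens (g * a) (h * b) = tens (g * a) (h * b) by [].
rewrite {1}tensMl (aut_act_morph aGH_action) tensMr (tensMr g).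
rewrite (tensMr (g * a)) (tensMl g a h) (aut_act_morph aHG_action) tensMl.
rewrite compat_lconj_G compat_lconj_H -(lconjM _ _ _ aGH_action).
rewrite -(lconjM _ _ _ aHG_action) !mulgA => /mulIg.
by rewrite -!mulgA => /mulgI.
Qed.

(** The hypotheses on [f (tens g h)] say, without inverses, that it acts on both
    entries as the commutator of [g] and [h].  By the preceding relation this is
    how conjugation by [tens g h] acts on the generators.  Hence [f t] acts on
    the generators as conjugation by [t] for every [t], and when [f t = 1] the
    element [t] commutes with all of them. *)
Lemma central_kernel_tensor (K : groupType) (phi : K -> G -> G)
    (psi : K -> H -> H) (f : {multiplicative tensor aGH aHG -> K}) :
  aut_action phi -> aut_action psi ->
  (forall g h a, phi (f (tens g h)) (aHG h (lconj g a)) = lconj g (aHG h a)) ->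
  (forall g h b, psi (f (tens g h)) (lconj h (aGH g b)) = aGH g (lconj h b)) ->
  central_kernel f.
Proof.
move=> phiA psiA phi_f psi_f.
have conj_tens t : forall a b,
    tens (phi (f t) a) (psi (f t) b) * t = t * tens a b.
  elim/presented_group_ind: t => [[g h]||t u tP uP|t tP] a b.
  - (* Every pair of entries is of the form required by the commutation
       relation, because the actions are invertible. *)
    rewrite -[pres_class _ _]/(tens g h).
    rewrite -[a](aut_actVK aHG_action h) -[aHG h^-1 a](aut_actVK (lconj_action G) g).
    rewrite -[b](aut_actVK (lconj_action H) h) -[lconj h^-1 b](aut_actVK aGH_action g).
    by rewrite phi_f psi_f tensor_sym_comm.
  - by rewrite mult1 (aut_act1 phiA) (aut_act1 psiA) mulg1 mul1g.
  - rewrite gmulfM (aut_actM phiA) (aut_actM psiA) mulgA tP.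
    by rewrite -!mulgA uP.
  - apply: (mulgI t); rewrite mulgA -tP multV.
    by rewrite (aut_actVK phiA) (aut_actVK psiA) mulgK mulVKg.
move=> t ft1 u; elim/presented_group_ind: u => [[g h]||u v tu tv|u tu].
- rewrite -[pres_class _ _]/(tens g h).
  rewrite /commute -conj_tens ft1.
  by rewrite (aut_act1 phiA) (aut_act1 psiA).
- exact: commute1.
- exact: commuteM.
- exact: commuteV.
Qed.

(** The witness sends [g (x) h] to [g * h.g^-1], the commutator of [g] and [h]
    evaluated in [G]; compatibility is what makes it act on [H] as that
    commutator. *)
Lemma tensor_central_kernel_l :
  exists f : {multiplicative tensor aGH aHG -> G}, central_kernel f.
Proof.
have [|f fE] := @pres_hom_exists _ (tensor_rel aGH aHG) G
    (fun gh => gh.1 * aHG gh.2 gh.1^-1).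
  move=> _ _ [g g' h|g h h'] /=; rewrite !(aut_actV aHG_action).
    rewrite compat_lconj_G (aut_act_morph aHG_action) /lconj.
    by rewrite !gnorm.
  have -> : aHG (lconj h h') (aHG h g) = aHG (h * h') g.
    by rewrite -(aut_actM aHG_action) /lconj mulgVK.
  by rewrite !gnorm.
exists f; apply: (central_kernel_tensor (lconj_action G) aGH_action).
- move=> g h a; rewrite fE /lconj /=.
  by rewrite !(aut_act_morph aHG_action) !(aut_actV aHG_action) !gnorm.
- move=> g h b; rewrite fE /= (aut_actM aGH_action) compat_lconj_H.
  by rewrite (aut_actK aGH_action).
Qed.

(** Here the witness sends [g (x) h] to [g.h * h^-1], the same commutator
    evaluated in [H]. *)
Lemma tensor_central_kernel_r :
  exists f : {multiplicative tensor aGH aHG -> H}, central_kernel f.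
Proof.
have [|f fE] := @pres_hom_exists _ (tensor_rel aGH aHG) H
    (fun gh => aGH gh.1 gh.2 * gh.2^-1).
  move=> _ _ [g g' h|g h h'] /=.
    have -> : aGH (lconj g g') (aGH g h) = aGH (g * g') h.
      by rewrite -(aut_actM aGH_action) /lconj mulgVK.
    by rewrite !gnorm.
  rewrite compat_lconj_H (aut_act_morph aGH_action) /lconj.
  by rewrite !gnorm.
exists f; apply: (central_kernel_tensor aHG_action (lconj_action H)).
- move=> g h a; rewrite fE /= (aut_actM aHG_action) (aut_actK aHG_action).
  exact: compat_lconj_G.
- move=> g h b; rewrite fE /lconj /=.
  by rewrite !(aut_act_morph aGH_action) !(aut_actV aGH_action) !gnorm.
Qed.

End Tensor.

Theorem corollary3p7 (G H : groupType)
    (aGH : G -> H -> H) (aHG : H -> G -> G)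
    (aGH_action : aut_action aGH) (aHG_action : aut_action aHG)
    (compat : compatible_actions aGH aHG) :
  (solvable_by_finite G \/ solvable_by_finite H ->
     solvable_by_finite (tensor aGH aHG)) /\
  (nilpotent_by_finite G \/ nilpotent_by_finite H ->
     nilpotent_by_finite (tensor aGH aHG)).
Proof.
have [fG fG_central] := tensor_central_kernel_l aGH_action aHG_action compat.
have [fH fH_central] := tensor_central_kernel_r aGH_action aHG_action compat.
split=> -[].
- exact: (by_finite_central_kernel solvable_central_kernel fG_central).
- exact: (by_finite_central_kernel solvable_central_kernel fH_central).
- exact: (by_finite_central_kernel nilpotent_central_kernel fG_central).
- exact: (by_finite_central_kernel nilpotent_central_kernel fH_central).
Qed.
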